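(* Let $G$ be a group and let $S$ be a finite generating subset of $G$ with $1\in S$. Put $\Gamma=\mathrm{Cay}(G,S)$ and assume that $\Gamma$ and $\Gamma^-$ are both degenerate. Then there is a finite subgroup $H$ of $G$ such that one of the following holds: (i) $H$ is a $2$-fragment of $\Gamma$ or a $2$-fragment of $\Gamma^-$; (ii) $\Gamma$ and $\Gamma^-$ are $2$-faithful Cauchy graphs and there exists an element $a\in G$ such that $H\cup Ha$ is a $2$-atom of $\Gamma$ or a $2$-atom of $\Gamma^-$.
   Context: $\mathrm{Cay}(G,S)$ is the graph $(G,E)$ with $E=\{(x,y): x^{-1}y\in S\}$; thus $\Gamma(X)=XS$, and its reverse graph $\Gamma^-=(G,\{(x,y):(y,x)\in E\})$ is $\mathrm{Cay}(G,S^{-1})$. For a graph $\Gamma=(V,E)$: $\partial(X)=\Gamma(X)\setminus X$, $\nabla(X)=V\setminus\Gamma(X)$; $\Gamma$ is $k$-separable if there is a finite $X$ with $|X|\ge k$, $|\nabla(X)|\ge k$, and then $\kappa_k(\Gamma)=\min\{|\partial(X)|: X\text{ finite},|X|\ge k,|\nabla(X)|\ge k\}$. A $k$-fragment is a finite $X$ with $|X|\ge k$, $|\nabla(X)|\ge k$, $|\partial(X)|=\kappa_k(\Gamma)$; a $k$-atom is a $k$-fragment of minimum cardinality. A graph is $k$-faithful if $|A|\le|\nabla(A)|$ for a $k$-atom $A$; a Cauchy graph if it is not $1$-separable or has a $1$-atom $A$ with $|A|=1$ or $|\nabla(A)|=1$; degenerate if it is $2$-separable and $\kappa_2=\kappa_1$.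 *)

(* Defs.v *)
From Stdlib Require Import List Arith.
Import ListNotations.
Set Implicit Arguments.

Section Defs.
Variable G : Type.

Definition is_group (mul : G -> G -> G) (one : G) (inv : G -> G) : Prop :=
  (forall x y z, mul x (mul y z) = mul (mul x y) z) /\
  (forall x, mul one x = x) /\ (forall x, mul x one = x) /\
  (forall x, mul (inv x) x = one) /\ (forall x, mul x (inv x) = one).

Definition card_is (A : G -> Prop) (n : nat) : Prop :=
  exists l : list G, NoDup l /\ length l = n /\ forall x, A x <-> In x l.

Definition finite (A : G -> Prop) : Prop := exists n, card_is A n.

Definition atleast (k : nat) (A : G -> Prop) : Prop :=
  exists l : list G, NoDup l /\ length l = k /\ forall x, In x l -> A x.

Definition generates (mul : G -> G -> G) (one : G) (inv : G -> G)
  (S : G -> Prop) : Prop :=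
  forall g, exists l : list G,
    Forall (fun s => S s \/ S (inv s)) l /\ g = fold_right mul one l.

Definition is_finite_subgroup (mul : G -> G -> G) (one : G) (inv : G -> G)
  (H : G -> Prop) : Prop :=
  finite H /\ H one /\ (forall x y, H x -> H y -> H (mul x y)) /\
  (forall x, H x -> H (inv x)).

Definition cay (mul : G -> G -> G) (inv : G -> G) (S : G -> Prop) : G -> G -> Prop :=
  fun x y => S (mul (inv x) y).

Definition rev_graph (E : G -> G -> Prop) : G -> G -> Prop := fun x y => E y x.

Definition nbr (E : G -> G -> Prop) (X : G -> Prop) : G -> Prop :=
  fun y => exists x, X x /\ E x y.
Definition bd (E : G -> G -> Prop) (X : G -> Prop) : G -> Prop :=
  fun y => nbr E X y /\ ~ X y.
Definition nabla (E : G -> G -> Prop) (X : G -> Prop) : G -> Prop :=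
  fun y => ~ nbr E X y.

Definition admissible (E : G -> G -> Prop) (k : nat) (X : G -> Prop) : Prop :=
  finite X /\ atleast k X /\ atleast k (nabla E X).

Definition separable (E : G -> G -> Prop) (k : nat) : Prop :=
  exists X, admissible E k X.

Definition is_kappa (E : G -> G -> Prop) (k n : nat) : Prop :=
  (exists X, admissible E k X /\ card_is (bd E X) n) /\
  (forall Y, admissible E k Y -> atleast n (bd E Y)).

Definition fragment (E : G -> G -> Prop) (k : nat) (X : G -> Prop) : Prop :=
  admissible E k X /\ exists n, is_kappa E k n /\ card_is (bd E X) n.

Definition atom (E : G -> G -> Prop) (k : nat) (X : G -> Prop) : Prop :=
  fragment E k X /\
  forall Y, fragment E k Y -> forall m, card_is X m -> atleast m Y.

Definition faithful (E : G -> G -> Prop) (k : nat) : Prop :=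
  exists A, atom E k A /\ exists n, card_is A n /\ atleast n (nabla E A).

Definition cauchy (E : G -> G -> Prop) : Prop :=
  ~ separable E 1 \/
  exists A, atom E 1 A /\ (card_is A 1 \/ card_is (nabla E A) 1).

Definition degenerate (E : G -> G -> Prop) : Prop :=
  separable E 2 /\ exists n, is_kappa E 2 n /\ is_kappa E 1 n.

End Defs.

(* Main.v *)
(** Write c for the common value of kappa_1 and kappa_2, so that |XS| >= |X| + c
    whenever X is nonempty and XS is not everything; by submodularity, equality
    passes to the union and the intersection of two meeting fragments whose
    union stays admissible.  If the reverse graph is not 2-faithful, then G is
    finite and a maximal 2-fragment of the graph is a block of left translation,
    hence a coset of a subgroup.  If the graph is 2-faithful and c + 1 < |S|,
    the same holds for a 2-atom, since two distinct translates cannot meet in one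
    point.  There remains the case of two Cauchy graphs with c + 1 = |S|.  A
    2-atom A through 1 is a union of right cosets of its left stabilizer.  If
    there are more than two of them, then distinct translates L of A for which
    LS avoids a fixed point w meet in at most one point and form a hyperforest.
    Hence the sum of |L n X| - 1 over those meeting a set X for which XS also
    avoids w is at most |X| - 1, and a suitable choice of translates violates
    this bound. *)

Require Import Defs.
From Stdlib Require Import List Arith.
From HB Require Import structures.
From mathcomp Require Import all_boot finmap zify.
From mathcomp.classical Require Import boolp.
Set Implicit Arguments.
Unset Strict Implicit.
Unset Printing Implicit Defensive.

Local Open Scope fset_scope.
Local Open Scope nat_scope.

(** * Product sets and translates in a group *)

Section Products.
Variable G : groupType.
Implicit Types (X Y Z S : {fset G}) (g x y s w : G).

Definition prodf X S : {fset G} := [fset (x * s)%g | x in X, s in S].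
Definition transl g X : {fset G} := [fset (g * x)%g | x in X].

Lemma prodfP X S y :
  reflect (exists2 x, x \in X & (x^-1 * y)%g \in S) (y \in prodf X S).
Proof.
apply: (iffP idP) => [/imfset2P[x /= xX [s /= sS ->]]|[x xX sS]].
  by exists x => //; rewrite mulKg.
by apply/imfset2P; exists x => //; exists (x^-1 * y)%g; rewrite ?mulVKg.
Qed.

Lemma mem_prodf X S x s : x \in X -> s \in S -> (x * s)%g \in prodf X S.
Proof. by move=> xX sS; apply/prodfP; exists x; rewrite ?mulKg. Qed.

Lemma mem_transl g X y : (y \in transl g X) = ((g^-1 * y)%g \in X).
Proof.
apply/imfsetP/idP => [[x /= xX ->]|yX]; first by rewrite mulKg.
by exists (g^-1 * y)%g; rewrite ?mulVKg.
Qed.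

Lemma translM g h X : transl g (transl h X) = transl (g * h)%g X.
Proof. by apply/fsetP=> y; rewrite !mem_transl invgM mulgA. Qed.

Lemma transl1 X : transl 1%g X = X.
Proof. by apply/fsetP=> y; rewrite mem_transl invg1 mul1g. Qed.

Lemma card_transl g X : #|` transl g X| = #|` X|.
Proof. by rewrite card_imfset //; exact: mulgI. Qed.

Lemma prodf_transl g X S : prodf (transl g X) S = transl g (prodf X S).
Proof.
apply/fsetP=> y; rewrite mem_transl.
apply/prodfP/prodfP=> -[x].
  by rewrite mem_transl => xX yS; exists (g^-1 * x)%g; rewrite // invgM invgK mulgA mulgK.
by move=> xX yS; exists (g * x)%g; rewrite ?mem_transl ?mulKg // invgM -mulgA.
Qed.

Lemma prodfU X Y S : prodf (X `|` Y) S = prodf X S `|` prodf Y S.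
Proof.
apply/fsetP=> y; rewrite in_fsetU; apply/prodfP/orP.
  by move=> [x]; rewrite in_fsetU => /orP[xX|xY] yS; [left|right]; apply/prodfP; exists x.
by move=> [] /prodfP[x xX yS]; exists x; rewrite // in_fsetU xX ?orbT.
Qed.

Lemma prodfS X Y S : X `<=` Y -> prodf X S `<=` prodf Y S.
Proof.
move=> /fsubsetP sXY; apply/fsubsetP=> y /prodfP[x xX yS].
by apply/prodfP; exists x; rewrite ?sXY.
Qed.

Lemma sub_prodf X S : 1%g \in S -> X `<=` prodf X S.
Proof. by move=> S1; apply/fsubsetP=> x xX; apply/prodfP; exists x; rewrite ?mulVg. Qed.

Lemma prodf1 x S : prodf [fset x] S = transl x S.
Proof.
apply/fsetP=> y; rewrite mem_transl; apply/prodfP/idP; last by exists x; rewrite ?in_fset1.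
by move=> [z]; rewrite in_fset1 => /eqP->.
Qed.

(** Products distribute over unions, and the product of an intersection lies in the intersection of
    the products. *)
Lemma prodf_submod X Y S :
  #|` prodf (X `|` Y) S| + #|` prodf (X `&` Y) S| <= #|` prodf X S| + #|` prodf Y S|.
Proof.
rewrite prodfU -[leqRHS]cardfsUI leq_add2l fsubset_leq_card // fsubsetI.
by rewrite !prodfS // ?fsubsetIl ?fsubsetIr.
Qed.

(** A finite witness bounds the complement from below even when G is infinite. *)
Definition coatleast k X := exists2 N : {fset G}, k <= #|` N| & [disjoint N & X].

Lemma coatleastS k X Y : X `<=` Y -> coatleast k Y -> coatleast k X.
Proof. by move=> sXY [N kN dNY]; exists N => //; apply: fdisjointWr dNY. Qed.

Lemma coatleast_transl k g X : coatleast k X -> coatleast k (transl g X).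
Proof.
move=> [N kN /fdisjointP dNX]; exists (transl g N); first by rewrite card_transl.
by apply/fdisjointP=> y; rewrite !mem_transl; apply: dNX.
Qed.

Lemma coatleast_gt0 k X : 0 < k -> coatleast k X -> exists w, w \notin X.
Proof.
move=> k0 [N kN /fdisjointP dNX].
have /fset0Pn[w wN] : N != fset0 by rewrite -cardfs_gt0; apply: leq_trans kN.
by exists w; apply: dNX.
Qed.

Lemma coatleast_out X w : w \notin X -> coatleast 1 X.
Proof. by exists [fset w]; rewrite ?cardfs1 // fdisjoint1X. Qed.

Definition subgroup (H : {fset G}) :=
  [/\ 1%g \in H, {in H &, forall x y, (x * y)%g \in H} & {in H, forall x, x^-1%g \in H}].

(** As 1 lies in X, each x of X lies in both X and xX, so xX = X: the block is its own left
    stabilizer. *)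
Lemma block_subgroup X : 1%g \in X ->
  (forall g, X `&` transl g X != fset0 -> transl g X = X) -> subgroup X.
Proof.
move=> X1 blk; have stab x : x \in X -> transl x X = X.
  move=> xX; apply: blk; apply/fset0Pn; exists x.
  by rewrite in_fsetI xX mem_transl mulVg.
split=> // [x y xX yX|x xX].
  by rewrite -(stab x) // mem_transl mulKg.
by rewrite -[_^-1%g]mulg1 -mem_transl stab.
Qed.

End Products.

(** * Submodularity and atoms *)

Section Isoperimetry.
Variables (G : groupType) (S : {fset G}) (c : nat).
Hypothesis kappa1 :
  forall X w, X != fset0 -> w \notin prodf X S -> #|` X| + c <= #|` prodf X S|.
Implicit Types (X Y T L A : {fset G}) (g w x y : G).

(** With 1 in S and c = kappa_2 these are the 2-fragments, and the smallest ones are the 2-atoms;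
    the additive form avoids truncated subtraction. *)
Definition frag X :=
  [/\ 1 < #|` X|, coatleast 2 (prodf X S) & #|` prodf X S| = #|` X| + c].

Definition min_frag A := frag A /\ forall X, frag X -> #|` A| <= #|` X|.

Lemma frag_transl g X : frag X -> frag (transl g X).
Proof.
by case=> X1 dX tX; split; rewrite ?prodf_transl ?card_transl //; apply: coatleast_transl.
Qed.

Lemma min_frag_transl g A : min_frag A -> min_frag (transl g A).
Proof. by case=> fA mA; split; [apply: frag_transl|rewrite card_transl]. Qed.

(** Submodularity bounds the two excesses |ZS| - |Z| by 2c in total, and [kappa1] bounds each below
    by c; w keeps both products proper. *)
Lemma tightUI X Y w :
  #|` prodf X S| = #|` X| + c -> #|` prodf Y S| = #|` Y| + c ->
  w \notin prodf (X `|` Y) S -> X `&` Y != fset0 ->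
  #|` prodf (X `|` Y) S| = #|` X `|` Y| + c /\
  #|` prodf (X `&` Y) S| = #|` X `&` Y| + c.
Proof.
move=> tX tY wXY nzI.
have sI : X `&` Y `<=` X `|` Y by rewrite (fsubset_trans (fsubsetIl _ _)) ?fsubsetUl.
have nzU : X `|` Y != fset0 by apply: fsubset_neq0 nzI.
have wI : w \notin prodf (X `&` Y) S.
  by apply: contra wXY; apply/fsubsetP/prodfS.
have := kappa1 nzU wXY; have := kappa1 nzI wI.
have := prodf_submod X Y S; have := cardfsUI X Y; lia.
Qed.

Lemma frag_sub X Y : frag X -> Y `<=` X -> 1 < #|` Y| ->
  #|` prodf Y S| = #|` Y| + c -> frag Y.
Proof. by case=> _ dX _ sYX Y1 tY; split=> //; apply: coatleastS dX; apply: prodfS. Qed.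

(** A tight subset inherits the missed points of A, so it is a fragment and cannot be smaller than
    A. *)
Lemma min_frag_sub A X : min_frag A -> X `<=` A -> 1 < #|` X| ->
  #|` prodf X S| = #|` X| + c -> X = A.
Proof.
move=> [fA mA] sXA X1 tX; apply/eqP; rewrite eqEfcard sXA /=.
by apply: mA; apply: (frag_sub fA).
Qed.

(* The products of two meeting fragments of size n cover at most 2n + c - 1
   points, while a faithful one has at least 2n + c points available. *)
Lemma min_frag_meet A g : min_frag A -> coatleast #|` A| (prodf A S) ->
  A `&` transl g A != fset0 ->
  1 < #|` A `&` transl g A| \/ c.+1 < #|` S| -> transl g A = A.
Proof.
set B := transl g A => mA [N NA dN] nzI big.
have mB : min_frag B by apply: min_frag_transl.
have [[A1 dA tA] _] := mA; have [[B1 _ tB] _] := mB.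
have cB : #|` B| = #|` A| by rewrite card_transl.
have [w0 w0A] := coatleast_gt0 (ltn0Sn 1) dA.
have w0I : w0 \notin prodf (A `&` B) S.
  by apply: contra w0A; apply/fsubsetP/prodfS/fsubsetIl.
have kI := kappa1 nzI w0I.
have [w wU] : exists w, w \notin prodf (A `|` B) S.
  have : ~~ (N `|` prodf A S `<=` prodf (A `|` B) S).
    apply/negP=> /fsubset_leq_card; have := prodf_submod A B S.
    have /eqP := dN; rewrite /fdisjoint => dN'.
    have := cardfsUI N (prodf A S); rewrite dN' cardfs0.
    have : 0 < #|` A `&` B| by rewrite cardfs_gt0.
    lia.
  by case/fsubsetPn=> w _ ?; exists w.
have [_ tI] := tightUI tA tB wU nzI.
(* A tight one-point intersection would give |S| = c + 1, against the second alternative. *)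
have I1 : 1 < #|` A `&` B|.
  case: big => // cS; rewrite ltnNge leq_eqVlt ltnS leqn0 cardfs_eq0 (negPf nzI) orbF.
  apply/negP=> /cardfs1P[x Ix]; move: tI.
  by rewrite Ix prodf1 card_transl cardfs1; lia.
have IA := min_frag_sub mA (fsubsetIl A B) I1 tI.
have IB := min_frag_sub mB (fsubsetIr A B) I1 tI.
by rewrite -[LHS]IB IA.
Qed.

Lemma min_frag_subgroup A : min_frag A -> coatleast #|` A| (prodf A S) ->
  c.+1 < #|` S| -> exists2 H, subgroup H & frag H.
Proof.
move=> mA fA cS.
have [a aA] : exists a, a \in A.
  by apply/fset0Pn; rewrite -cardfs_gt0; case: mA => -[]; lia.
have mB := min_frag_transl a^-1%g mA.
exists (transl a^-1%g A); last by case: mB.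
apply: block_subgroup => [|g nz]; first by rewrite mem_transl invgK mulg1.
apply: min_frag_meet nz _; rewrite ?prodf_transl ?card_transl //; last by right.
exact: coatleast_transl.
Qed.

(** * Tight sets whose products miss a fixed point *)

Section Singletons.
Hypothesis cS : #|` S| = c.+1.
Variables (n : nat) (w : G).
Hypothesis n3 : 2 < n.

(** With w fixed, the product of a union also misses w, so [tightUI] applies to every meeting
    pair. *)
Definition avoiding T := #|` prodf T S| = #|` T| + c /\ w \notin prodf T S.

Definition line L := [/\ min_frag L, #|` L| = n & w \notin prodf L S].

Lemma avoidingU X Y : avoiding X -> avoiding Y -> X `&` Y != fset0 -> avoiding (X `|` Y).
Proof.
move=> [tX wX] [tY wY] nzI; have wU : w \notin prodf (X `|` Y) S.
  by rewrite prodfU in_fsetU negb_or wX.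
by split=> //; have [] := tightUI tX tY wU nzI.
Qed.

Lemma line_avoiding L : line L -> avoiding L.
Proof. by case=> -[[_ _ tL] _] _ wL. Qed.

(** An intersection with two points is tight, hence all of L by minimality. *)
Lemma line_meet T L : avoiding T -> line L -> #|` L `&` T| <= 1 \/ L `<=` T.
Proof.
move=> [tT wT] lL; have [mL nL wL] := lL.
have [?|I1] := leqP; [by left|right].
have wU : w \notin prodf (L `|` T) S by rewrite prodfU in_fsetU negb_or wL.
have nzI : L `&` T != fset0 by rewrite -cardfs_gt0; lia.
have [_ tI] := tightUI (proj1 (line_avoiding lL)) tT wU nzI.
by rewrite -(min_frag_sub mL (fsubsetIl _ _) I1 tI) fsubsetIr.
Qed.

Lemma line_pair L L' : line L -> line L' -> L != L' -> #|` L' `&` L| <= 1.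
Proof.
move=> lL lL' neq; have [//|sub] := line_meet (line_avoiding lL) lL'.
by move: neq; rewrite eq_sym eqEfcard sub; case: lL => _ -> _; case: lL' => _ -> _; rewrite leqnn.
Qed.

(** Because |S| = c + 1, single points are tight, so a forest may start at any such point. *)
Lemma avoiding1 x : w \notin transl x S -> avoiding [fset x].
Proof. by move=> wx; split; rewrite prodf1 // card_transl cardfs1 cS add1n. Qed.

(* Lines behave like the edges of a hyperforest: grow a connected union T of
   lines, each new line meeting it in exactly one point; when no line meets T,
   restart from a single point of Y. *)
Lemma forest_bound_from (F : {fset {fset G}}) T Y :
  avoiding T -> (forall L, L \in F -> line L /\ #|` L `&` T| <= 1) ->
  (forall y, y \in Y -> w \notin transl y S) -> [disjoint Y & T] ->
  \sum_(L <- F) (#|` L `&` (Y `|` T)| - 1) <= #|` Y|.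
Proof.
have [m] := ubnP (#|` F| + #|` Y|); elim: m => // m IH in F T Y * => lt_m aT lF wY dYT.
have [/existsP[[L LF] /= meet]|] := boolP [exists L : F, fsval L `&` T != fset0].
  have [lL LT1] := lF _ LF; have aL := line_avoiding lL.
  have LT : #|` L `&` T| = 1 by apply/eqP; rewrite eqn_leq LT1 cardfs_gt0.
  have aU : avoiding (T `|` L) by apply: avoidingU; rewrite // fsetIC.
  have cF : #|` F| = 1 + #|` F `\ L| by rewrite (cardfsD1 L F) LF.
  have cY : #|` Y| = #|` Y `&` L| + #|` Y `\` L| by rewrite cardfsID.
  have le : \sum_(L' <- F `\ L) (#|` L' `&` (Y `\` L `|` (T `|` L))| - 1) <= #|` Y `\` L|.
    apply: IH => //.
    + lia.
    + move=> L'; rewrite in_fsetD1 => /andP[nLL' L'F].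
      have [lL' L'T] := lF _ L'F; split=> //.
      have [//|sub] := line_meet aU lL'.
      have := line_pair lL lL'; rewrite eq_sym => /(_ nLL') L'L.
      (* Inside the union of T and L, the n > 2 points of L' would be split between two sets that it
         meets in at most one point each. *)
      have /fsetIidPl sub' := sub; rewrite fsetIUr in sub'.
      have := cardfsUI (L' `&` T) (L' `&` L); rewrite sub'.
      by case: lL' => _ -> _; lia.
    + by move=> y; rewrite in_fsetD => /andP[_ /wY].
    + apply/fdisjointP=> y; rewrite in_fsetD in_fsetU negb_or => /andP[-> yY].
      by rewrite (fdisjointP dYT).
  rewrite (big_fsetD1 L) //= cY; apply: leq_add.
    (* The single point of L in T absorbs the subtracted 1, leaving at most the points of Y that
       move into T. *)
    have -> : L `&` (Y `|` T) = (Y `&` L) `|` (L `&` T) by rewrite fsetIUr (fsetIC L Y).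
    by rewrite leq_subLR -LT [leqRHS]addnC -cardfsUI leq_addr.
  apply: leq_trans le; apply: leq_sum => L' _.
  apply/leq_sub2r/fsubset_leq_card/fsetIS/fsubsetP=> y; rewrite !inE.
  by case: (y \in L); case: (y \in Y); case: (y \in T).
move=> /existsPn nomeet.
have nI L : L \in F -> L `&` T = fset0.
  by move=> LF; have := nomeet [` LF]; rewrite negbK => /eqP.
have [->|/fset0Pn[y yY]] := eqVneq Y fset0.
  by rewrite fset0U big_seq big1 // => L /nI ->; rewrite cardfs0.
have cY : #|` Y| = 1 + #|` Y `\ y| by rewrite (cardfsD1 y Y) yY.
have le : \sum_(L <- F) (#|` L `&` (Y `\ y `|` [fset y])| - 1) <= #|` Y `\ y|.
  apply: IH => //.
  - lia.
  - exact/avoiding1/wY.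
  - move=> L /lF[lL _]; split=> //.
    by rewrite -[leqRHS](cardfs1 y) fsubset_leq_card ?fsubsetIr.
  - by move=> z; rewrite in_fsetD1 => /andP[_ /wY].
  - by rewrite fdisjointX1 in_fsetD1 eqxx.
rewrite fsetUC fsetD1K // in le; rewrite cY.
apply: leq_trans (leq_trans le (leq_addl _ _)).
rewrite big_seq [leqRHS]big_seq; apply: leq_sum => L /nI LT.
by rewrite fsetIUr LT fsetU0.
Qed.

(** Starting the forest at a point of X leaves |X| - 1 points to be reached. *)
Lemma forest_bound (F : {fset {fset G}}) X :
  (forall L, L \in F -> line L) -> (forall x, x \in X -> w \notin transl x S) ->
  \sum_(L <- F) (#|` L `&` X| - 1) <= #|` X| - 1.
Proof.
move=> lF wX; have [->|/fset0Pn[x xX]] := eqVneq X fset0.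
  by rewrite big1 // => L _; rewrite fsetI0 cardfs0.
have := @forest_bound_from F [fset x] (X `\ x).
rewrite fsetUC fsetD1K // (cardfsD1 x X) xX add1n subn1; apply.
- exact/avoiding1/wX.
- move=> L /lF lL; split=> //.
  by rewrite -[leqRHS](cardfs1 x) fsubset_leq_card ?fsubsetIr.
- by move=> y; rewrite in_fsetD1 => /andP[_ /wX].
- by rewrite fdisjointX1 in_fsetD1 eqxx.
Qed.

End Singletons.
End Isoperimetry.

Lemma sum_fset_const (T : choiceType) (Z : {fset T}) k :
  \sum_(z <- Z) k = #|` Z| * k.
Proof. by rewrite card_fset_sum1 big_distrl /=; apply: eq_bigr => z _; rewrite mul1n. Qed.

(** * Atoms as unions of cosets when |S| = c + 1 *)

Section TwoCosets.
Variables (G : groupType) (S : {fset G}) (c : nat).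
Hypothesis S1 : 1%g \in S.
Hypothesis kappa1 :
  forall X w, X != fset0 -> w \notin prodf X S -> #|` X| + c <= #|` prodf X S|.
Hypothesis cS : #|` S| = c.+1.
Variable A : {fset G}.
Hypotheses (mA : min_frag S c A) (A1 : 1%g \in A).
Implicit Types (X Z L : {fset G}) (x y z w : G).

(** Restricting x to A loses nothing, as 1 lies in A, and yields a finite set. *)
Definition lstab : {fset G} := [fset x in A | transl x A == A].

Lemma lstabP x : reflect (transl x A = A) (x \in lstab).
Proof.
rewrite in_fset inE /=; apply: (iffP andP) => [[_ /eqP//]|stab]; split; last exact/eqP.
by rewrite -stab mem_transl mulVg.
Qed.

Lemma lstab_subgroup : subgroup lstab.
Proof.
split=> [|x y /lstabP sx /lstabP sy|x /lstabP sx]; apply/lstabP.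
- exact: transl1.
- by rewrite -translM sy.
- by rewrite -{1}sx translM mulVg transl1.
Qed.

Lemma lstab_rcoset a : a \in A -> [fset (h * a)%g | h in lstab] `<=` A.
Proof.
move=> aA; apply/fsubsetP=> _ /imfsetP[h /= /lstabP hA ->].
by rewrite -hA mem_transl mulKg.
Qed.

Lemma card_rcoset a : #|` [fset (h * a)%g | h in lstab]| = #|` lstab|.
Proof. by rewrite card_imfset //; exact: mulIg. Qed.

(** A is a union of right cosets of its stabilizer, and distinct cosets are disjoint; up to three
    are peeled off, starting with the stabilizer itself. *)
Lemma three_rcosets :
  A = lstab \/ (exists a, A = lstab `|` [fset (h * a)%g | h in lstab])
  \/ 3 * #|` lstab| <= #|` A|.
Proof.
have [H1 HM HV] := lstab_subgroup.
have sub : lstab `<=` A by apply/fsubsetP=> x; rewrite in_fset inE => /andP[].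
have [sub2|/fsubsetPn[a aA aH]] := boolP (A `<=` lstab).
  by left; apply/eqP; rewrite eqEfsubset sub2.
right; set Ha := [fset (h * a)%g | h in lstab].
have sU : lstab `|` Ha `<=` A by rewrite fsubUset sub lstab_rcoset.
have [sub2|/fsubsetPn[b bA]] := boolP (A `<=` lstab `|` Ha).
  by left; exists a; apply/eqP; rewrite eqEfsubset sub2.
rewrite in_fsetU negb_or => /andP[bH bHa]; right.
set Hb := [fset (h * b)%g | h in lstab].
have /fsubset_leq_card : lstab `|` Ha `|` Hb `<=` A by rewrite fsubUset sU lstab_rcoset.
have d1 : lstab `&` Ha = fset0.
  apply/eqP; apply/fdisjointP=> x xH; apply: contra aH => /imfsetP[h /= hH def_x].
  by rewrite -[a](mulKg h) -def_x HM ?HV.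
have d2 : (lstab `|` Ha) `&` Hb = fset0.
  apply/eqP; apply/fdisjointP=> x xHa; apply/imfsetP=> -[h /= hH def_x].
  have def_b : b = (h^-1 * x)%g by rewrite def_x mulKg.
  move: xHa; rewrite in_fsetU => /orP[xH|/imfsetP[k /= kH def_x']].
    by move: bH; rewrite def_b HM ?HV.
  case/imfsetP: bHa; exists (h^-1 * k)%g; first by rewrite HM ?HV.
  by rewrite def_b def_x' mulgA.
have := cardfsUI (lstab `|` Ha) Hb; have := cardfsUI lstab Ha.
rewrite d1 d2 cardfs0 !card_rcoset; lia.
Qed.

(** Each translate L arises from at most |[lstab]| elements: once z0 gives L, the map sending y to
    z0 y^-1 injects its fibre into the stabilizer. *)
Lemma sum_translates Z (f : {fset G} -> nat) :
  \sum_(z <- Z) f (transl z^-1%g A) <=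
    #|` lstab| * \sum_(L <- [fset transl z^-1%g A | z in Z]) f L.
Proof.
rewrite (partition_big_imfset _ (fun z => transl z^-1%g A)) /= big_distrr /=.
apply: leq_sum => L _; rewrite big_mkcond /=.
set Y := [fset z in Z | transl z^-1%g A == L].
have -> : \sum_(z <- Z) (if transl z^-1%g A == L then f (transl z^-1%g A) else 0)
          = #|` Y| * f L.
  rewrite -big_mkcond (eq_bigr (fun=> f L)); last by move=> z /eqP->.
  by rewrite big_fset_condE sum_fset_const.
rewrite leq_mul2r; apply/orP; right.
have [->|/fset0Pn[z0]] := eqVneq Y fset0; first by rewrite cardfs0.
rewrite !inE /= => /andP[_ /eqP z0L].
have <- : #|` [fset (z0 * y^-1)%g | y in Y]| = #|` Y|.
  by rewrite card_imfset // => x y /mulgI /invg_inj.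
apply/fsubset_leq_card/fsubsetP=> _ /imfsetP[z /= zY ->]; apply/lstabP.
move: zY; rewrite !inE /= => /andP[_ /eqP zL].
by rewrite -translM zL -z0L translM mulgV transl1.
Qed.

(** The product of z^-1 A with S misses w when zw lies outside AS, so [forest_bound] applies;
    repeated translates cost the factor |[lstab]|. *)
Lemma translates_bound Z X w : 2 < #|` A| ->
  (forall z, z \in Z -> (z * w)%g \notin prodf A S) ->
  (forall x, x \in X -> w \notin transl x S) ->
  \sum_(z <- Z) (#|` transl z^-1%g A `&` X| - 1) <= #|` lstab| * (#|` X| - 1).
Proof.
move=> A3 wZ wX.
apply: leq_trans (sum_translates Z (fun L => #|` L `&` X| - 1)) _.
rewrite leq_mul2l; apply/orP; right.
apply: (forest_bound kappa1 cS A3) wX => _ /imfsetP[z /= zZ ->].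
split; rewrite ?card_transl //; first exact: min_frag_transl.
by rewrite prodf_transl mem_transl invgK wZ.
Qed.

(* Take w = 1, let z range over the complement of AS, and let X be the
   complement of S^-1, which contains all these translates z^-1 A. *)
Lemma finite_large_atom (U : {fset G}) : (forall x, x \in U) ->
  coatleast #|` A| (prodf A S) -> 2 < #|` A| -> 3 * #|` lstab| <= #|` A| -> False.
Proof.
move=> allU [N NA /fdisjointP dN] A3 q3.
have [H1 _ _] := lstab_subgroup.
have q0 : 0 < #|` lstab| by rewrite cardfs_gt0; apply/fset0Pn; exists 1%g.
set Z := U `\` prodf A S; set Si : {fset G} := [fset x^-1%g | x in S].
set X := U `\` Si.
have cSi : #|` Si| = c.+1 by rewrite card_imfset //; exact: invg_inj.
have cX : #|` X| + c.+1 = #|` U|.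
  by rewrite -(cardfsID Si U) addnC -cSi; congr (#|` _| + _); apply/fsetP=> x; rewrite in_fsetI allU.
have cZ : #|` Z| + (#|` A| + c) = #|` U|.
  have [[_ _ <-] _] := mA; rewrite -(cardfsID (prodf A S) U) addnC; congr (#|` _| + _).
  by apply/fsetP=> x; rewrite in_fsetI allU.
have NZ : #|` A| <= #|` Z|.
  apply: leq_trans NA _; apply/fsubset_leq_card/fsubsetP=> x xN.
  by rewrite in_fsetD allU dN.
have := @translates_bound Z X 1%g A3.
rewrite big_seq (eq_bigr (fun=> #|` A| - 1)); last first.
  (* If s^-1 lay in z^-1 A with s in S, then z = (z s^-1) s would lie in AS. *)
  move=> z; rewrite in_fsetD => /andP[zAS _]; congr (_ - 1).
  rewrite -[RHS](card_transl z^-1%g A); congr #|` _|; apply/fsetIidPl/fsubsetP=> y.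
  rewrite mem_transl invgK in_fsetD allU andbT => zyA; apply: contra zAS.
  move=> /imfsetP[s /= sS def_y]; rewrite -[z](mulgK y) def_y invgK -def_y.
  exact: mem_prodf.
rewrite -big_seq sum_fset_const.
have -> : #|` X| - 1 = #|` Z| + (#|` A| - 2) by move: cX; rewrite -cZ; lia.
move=> bound; have {bound} : 3 * (#|` Z| * (#|` A| - 1)) <= #|` A| * (#|` Z| + (#|` A| - 2)).
  apply: leq_trans (leq_mul q3 (leqnn _)); rewrite -mulnA leq_mul2l bound // => [z|x].
    by rewrite in_fsetD mulg1 => /andP[].
  rewrite in_fsetD mem_transl mulg1 => /andP[xSi _]; apply: contra xSi => xS.
  by apply/imfsetP; exists x^-1%g; rewrite ?invgK.
(* With n = |A| <= m = |Z|, the right side n(m + n - 2) is at most 2m(n - 1), which is less than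
   3m(n - 1). *)
nia.
Qed.

(* Let z range over AS and put X = S^-1: counting the solutions of z = as gives
   the sum of the |z^-1 A \cap X|. *)
Lemma infinite_large_atom : (forall U : {fset G}, exists x, x \notin U) ->
  2 < #|` A| -> 3 * #|` lstab| <= #|` A| -> False.
Proof.
move=> inf A3 q3.
set Z := prodf A S; set X : {fset G} := [fset x^-1%g | x in S].
have memX x : (x \in X) = (x^-1%g \in S).
  by apply/imfsetP/idP => [[s /= sS ->]|xS]; [rewrite invgK|exists x^-1%g; rewrite ?invgK].
have cX : #|` X| = c.+1 by rewrite card_imfset //; exact: invg_inj.
have cZ : #|` Z| = #|` A| + c by case: mA => -[].
(* Outside Z^-1 Z and XS, w satisfies both conditions: zw avoids Z for z in Z, and w avoids xS for x
   in X. *)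
have [w] := inf (prodf [fset z^-1%g | z in Z] Z `|` prodf X S).
rewrite in_fsetU negb_or => /andP[wZ wX].
have := @translates_bound Z X w A3; rewrite cX subn1 /=.
(* The intersections have total size |A|(c + 1); subtracting 1 for each of the |A| + c elements of Z
   leaves (|A| - 1)c. *)
have -> : \sum_(z <- Z) (#|` transl z^-1%g A `&` X| - 1) = (#|` A| - 1) * c.
  have count : \sum_(z <- Z) #|` transl z^-1%g A `&` X| = #|` A| * c.+1.
    rewrite -cX (eq_big_seq (fun z => \sum_(x <- X | x \in transl z^-1%g A) 1)); last first.
      move=> z _; rewrite big_fset_condE -card_fset_sum1; congr #|` _|.
      by apply/fsetP=> x; rewrite !inE andbC.
    rewrite (exchange_big_dep xpredT) //= mulnC -sum_fset_const.
    apply: eq_big_seq => x xX; rewrite big_fset_condE -card_fset_sum1.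
    have <- : #|` [fset (a * x^-1)%g | a in A]| = #|` A|.
      by rewrite card_imfset //; exact: mulIg.
    congr #|` _|.
    apply/fsetP=> z; rewrite !inE /= mem_transl invgK.
    apply/andP/imfsetP => [[zZ zxA]|[a /= aA ->]]; first by exists (z * x)%g; rewrite ?mulgK.
    by rewrite mulgVK mem_prodf // -memX.
  (* Truncated subtraction is exact here: if z = as, then s^-1 = z^-1 a lies in the intersection. *)
  have ge1 z : z \in Z -> 0 < #|` transl z^-1%g A `&` X|.
    move=> /prodfP[a aA azS]; rewrite cardfs_gt0; apply/fset0Pn; exists (z^-1 * a)%g.
    by rewrite in_fsetI mem_transl mulKg aA memX invgM invgK.
  have : \sum_(z <- Z) ((#|` transl z^-1%g A `&` X| - 1) + 1) = #|` A| * c.+1.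
    rewrite -count; apply: eq_big_seq => z /ge1; lia.
  rewrite big_split /= sum_fset_const muln1 mulnS mulnBl mul1n cZ addnCA.
  by move/addnI <-; rewrite addnK.
move=> bound; have {bound} : (#|` A| - 1) * c <= #|` lstab| * c.
  apply: bound => [z zZ|x xX].
    apply: contra wZ => zw; apply/prodfP; exists z^-1%g; last by rewrite invgK.
    by apply/imfsetP; exists z.
  by apply: contra wX; rewrite mem_transl => xw; apply/prodfP; exists x.
(* If c > 0, then |A| - 1 <= |[lstab]| <= |A|/3, which is absurd. If c = 0, then S = {1}, every pair
   in A is tight, and A has only two points. *)
rewrite leq_mul2r => /orP[/eqP c0|]; last lia.
have [b] : exists b, b \in A `\ 1%g.
  by apply/fset0Pn; rewrite -cardfs_gt0; move: A3; rewrite (cardfsD1 1%g A) A1; exact: ltnW.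
rewrite in_fsetD1 => /andP[b1 bA].
have S_1 : S = [fset 1%g].
  by move/eqP: cS; rewrite c0 => /cardfs1P[s Ss]; move: S1; rewrite Ss in_fset1 => /eqP <-.
have XA : [fset 1%g; b] = A.
  apply: (min_frag_sub mA).
  - by apply/fsubsetP=> x /fset2P[->|->].
  - by rewrite cardfs2 eq_sym b1.
  rewrite c0 addn0 S_1; congr #|` _|; apply/fsetP=> y; apply/prodfP/idP.
    by move=> [x xX]; rewrite in_fset1 -[y in y \in _](mulVKg x) => /eqP ->; rewrite mulg1.
  by move=> yX; exists y; rewrite // mulVg in_fset1.
by move: A3; rewrite -XA cardfs2; case: (1%g == b).
Qed.

Lemma min_frag_two_cosets : coatleast #|` A| (prodf A S) ->
  exists2 H, subgroup H & A = H \/ exists a, A = H `|` [fset (h * a)%g | h in H].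
Proof.
move=> fA; exists lstab; first exact: lstab_subgroup.
have [|[|q3]] := three_rcosets; [by left|by right|exfalso].
have q0 : 0 < #|` lstab|.
  by rewrite cardfs_gt0; apply/fset0Pn; exists 1%g; case: lstab_subgroup.
have A3 : 2 < #|` A| by lia.
have [[U allU]|inf] := pselect (exists U : {fset G}, forall x, x \in U).
  exact: (finite_large_atom allU).
apply: infinite_large_atom => // U; apply: contrapT => noU; apply: inf.
by exists U => x; apply: contrapT => xU; apply: noU; exists x; apply/negP.
Qed.

End TwoCosets.

(** * Complementary fragments in the reverse graph *)

Section Duality.
Variable G : groupType.
Implicit Types (S T X F U : {fset G}) (x y z w : G).

Lemma coatleast_infinite : (forall U, exists x, x \notin U) -> forall k X, coatleast k X.
Proof.
move=> inf; elim=> [|k IH] X; first by exists fset0; rewrite ?fdisjoint0X.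
have [N kN dN] := IH X; have [x] := inf (N `|` X).
rewrite in_fsetU negb_or => /andP[xN xX]; exists (x |` N).
  by rewrite cardfsU1 xN.
by rewrite fdisjointU1X xX.
Qed.

(** If x = yt with t in T = S^-1, then y = x t^-1 lies in XS. *)
Lemma prodf_codisjoint S T U X : (forall x, (x \in T) = (x^-1%g \in S)) ->
  [disjoint X & prodf (U `\` prodf X S) T].
Proof.
move=> TS; apply/fdisjointP=> x xX; apply/prodfP=> -[y].
rewrite in_fsetD => /andP[/prodfP yX _]; rewrite TS invgM invgK => xyS.
by apply: yX; exists x.
Qed.

Section Finite.
Variable U : {fset G}.
Hypothesis allU : forall x, x \in U.

Lemma card_compl X : #|` X| + #|` U `\` X| = #|` U|.
Proof. by rewrite -[RHS](cardfsID X); congr (#|` _| + _); apply/fsetP=> x; rewrite in_fsetI allU. Qed.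

Lemma coatleast_compl k X : coatleast k X <-> k <= #|` U `\` X|.
Proof.
split=> [[N kN /fdisjointP dN]|kU]; last first.
  by exists (U `\` X) => //; apply/fdisjointP=> x; rewrite in_fsetD => /andP[].
apply: leq_trans kN _; apply/fsubset_leq_card/fsubsetP=> x xN.
by rewrite in_fsetD allU dN.
Qed.

(** Let F' be the complement of FS. Then |F'| = |U| - |F| - c, and F'T misses F, so the excess of F'
    is at most c; it is at least d by hypothesis. *)
Lemma frag_compl S T c d F : (forall x, (x \in T) = (x^-1%g \in S)) ->
  (forall X w, X != fset0 -> w \notin prodf X T -> #|` X| + d <= #|` prodf X T|) ->
  frag S c F -> d <= c /\ (d = c -> frag T d (U `\` prodf F S)).
Proof.
move=> TS kappa [F1 dF tF]; set F' := U `\` prodf F S.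
have dis := prodf_codisjoint U F TS; rewrite -/F' in dis.
have F'1 : 1 < #|` F'| by apply/coatleast_compl.
have [w wF] : exists w, w \in F by apply/fset0Pn; rewrite -cardfs_gt0 ltnW.
have le_d : #|` F'| + d <= #|` prodf F' T|.
  by apply: kappa (fdisjointP dis _ wF); rewrite -cardfs_gt0 ltnW.
have le_c : #|` prodf F' T| + #|` F| <= #|` U|.
  rewrite -(card_compl (prodf F' T)) leq_add2l; apply/coatleast_compl.
  by exists F.
have := card_compl (prodf F S); rewrite -/F' tF => cU.
split=> [|dc]; first lia.
by split=> //; [exists F|lia].
Qed.

(* A fragment F of maximal size has |F| < |U \ FS|, so the union of F and of a
   translate meeting F is again a fragment. *)
Lemma max_frag_subgroup S c F :
  (forall X w, X != fset0 -> w \notin prodf X S -> #|` X| + c <= #|` prodf X S|) ->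
  frag S c F -> (forall X, frag S c X -> #|` X| <= #|` F|) ->
  #|` F| < #|` U `\` prodf F S| -> exists2 H, subgroup H & frag S c H.
Proof.
move=> kappa fF maxF ltF.
have [a aF] : exists a, a \in F.
  by apply/fset0Pn; rewrite -cardfs_gt0; case: fF => /ltnW.
have fH := frag_transl a^-1%g fF.
exists (transl a^-1%g F); last by [].
have cH := card_transl a^-1%g F; move: (transl a^-1%g F) fH cH (mem_transl a^-1%g F 1%g).
rewrite invgK mulg1 aF => H fH cH H1.
apply: block_subgroup => // g nzI; have fB := frag_transl g fH.
set B := transl g H in nzI fB *.
have cB : #|` B| = #|` H| by rewrite card_transl.
have [H2 dH tH] := fH; have [_ dB tB] := fB; have [_ _ tF] := fF.
have [w wH] := coatleast_gt0 (ltn0Sn 1) dH.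
have wI : w \notin prodf (H `&` B) S.
  by apply: contra wH; apply/fsubsetP/prodfS/fsubsetIl.
have kI := kappa _ _ nzI wI.
have I1 : 0 < #|` H `&` B| by rewrite cardfs_gt0.
(* The product of the union has at most 2|F| + c - 1 points, while |U| >= 2|F| + c + 1 by [ltF], so
   two points are left. *)
have dU : coatleast 2 (prodf (H `|` B) S).
  apply/coatleast_compl.
  have := card_compl (prodf (H `|` B) S); have := card_compl (prodf F S).
  have := prodf_submod H B S; lia.
have [v vU] := coatleast_gt0 (ltn0Sn 1) dU.
have [tU _] := tightUI kappa tH tB vU nzI.
have fU : frag S c (H `|` B).
  by split=> //; apply: leq_trans H2 _; apply/fsubset_leq_card/fsubsetUl.
have := maxF _ fU; rewrite -cH => le.
have HU : H = H `|` B by apply/eqP; rewrite eqEfcard fsubsetUl.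
by apply/eqP; rewrite eqEfcard cB leqnn andbT [X in _ `<=` X]HU fsubsetUr.
Qed.

End Finite.

(** Unfaithfulness forces G to be finite. The complement F of AT is then an S-fragment smaller than
    A, while every S-fragment X leaves at least |A| points outside XS, as these form a T-fragment.
    Hence F has maximal size. *)
Lemma unfaithful_subgroup S T c d A :
  (forall x, (x \in T) = (x^-1%g \in S)) ->
  (forall X w, X != fset0 -> w \notin prodf X S -> #|` X| + c <= #|` prodf X S|) ->
  (forall X w, X != fset0 -> w \notin prodf X T -> #|` X| + d <= #|` prodf X T|) ->
  (exists F, frag S c F) -> min_frag T d A -> ~ coatleast #|` A| (prodf A T) ->
  exists2 H, subgroup H & frag S c H.
Proof.
move=> TS kappaS kappaT [F0 fF0] [fA mA] nfA.
have [[U allU]|inf] := pselect (exists U : {fset G}, forall x, x \in U); last first.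
  case: nfA; apply: coatleast_infinite => U; apply: contrapT => noU; apply: inf.
  by exists U => x; apply: contrapT => xU; apply: noU; exists x; apply/negP.
have ST x : (x \in S) = (x^-1%g \in T) by rewrite TS invgK.
(* Complementing fragments in both directions shows c = d. *)
have [le_dc _] := frag_compl allU TS kappaT fF0.
have [le_cd fF] := frag_compl allU ST kappaS fA.
have cd : c = d by lia.
have {}fF := fF cd; set F := U `\` prodf A T in fF.
have ltA : #|` F| < #|` A|.
  by rewrite ltnNge; apply/negP=> leA; apply: nfA; exact/(coatleast_compl allU).
have minA X : frag S c X -> #|` A| <= #|` U `\` prodf X S|.
  by move=> fX; apply: mA; have [_] := frag_compl allU TS kappaT fX; apply.
apply: (max_frag_subgroup allU kappaS fF) => [X fX|].
  have := minA X fX; have := card_compl allU (prodf X S); have := card_compl allU (prodf A T).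
  case: fX => _ _ ->; case: fA => _ _ ->; rewrite -/F; lia.
exact: leq_trans ltA (minA _ fF).
Qed.

End Duality.

(** * Finite predicates as finite sets *)

Section FiniteSets.
Variable G : choiceType.
Implicit Types (l : seq G) (P : G -> Prop) (X N : {fset G}).

Lemma InP l x : List.In x l <-> x \in l.
Proof.
elim: l => [|y l IH] //=; rewrite in_cons -(rwP orP) -(rwP eqP) IH.
by split=> -[->|]; auto.
Qed.

Lemma NoDupP l : NoDup l <-> uniq l.
Proof.
elim: l => [|y l IH]; first by split=> // _; constructor.
split=> [nd|/= /andP[yl ul]].
  inversion nd; subst; rewrite /= (introT idP (proj1 IH _)) // andbT.
  by apply/negP=> /InP.
by constructor; [rewrite InP; apply/negP|apply/IH].
Qed.

Definition fset_pred X : G -> Prop := fun x => x \in X.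

Lemma card_is_fset X n : card_is (fset_pred X) n <-> #|` X| = n.
Proof.
split=> [[l [/NoDupP ul [<- Xl]]]|<-].
  have -> : X = [fset x in l] by apply/fsetP=> x; rewrite inE /=; apply/idP/idP => [/Xl/InP|/InP/Xl].
  by rewrite card_fseq undup_id.
by exists X; split; [apply/NoDupP/fset_uniq|split=> // x; rewrite InP].
Qed.

Lemma card_isE P n : card_is P n -> exists X, P = fset_pred X.
Proof.
move=> [l [_ [_ Pl]]]; exists [fset x in l]; apply/funext=> x; apply/propext.
by rewrite Pl InP /fset_pred inE.
Qed.

Lemma atleastE k P : atleast k P <-> exists2 N, k <= #|` N| & forall x, x \in N -> P x.
Proof.
split=> [[l [/NoDupP ul [<- lP]]]|[N kN NP]].
  exists [fset x in l]; first by rewrite card_fseq undup_id.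
  by move=> x; rewrite inE => /InP/lP.
exists (take k N); split; first exact/NoDupP/take_uniq/fset_uniq.
split; first exact: size_takel.
by move=> x /InP /mem_take /NP.
Qed.

Lemma atleast_fset k X : atleast k (fset_pred X) <-> k <= #|` X|.
Proof.
rewrite atleastE; split=> [[N kN /fsubsetP sNX]|]; last by exists X.
exact: leq_trans kN (fsubset_leq_card sNX).
Qed.

End FiniteSets.

(** * Graph notions in terms of product sets, for the graph and its reverse alike *)

Section Bridge.
Variables (G : groupType) (S : {fset G}) (E : G -> G -> Prop).
Hypothesis S1 : 1%g \in S.
Hypothesis ES : forall x y, E x y <-> (x^-1 * y)%g \in S.
Implicit Types (X A : {fset G}) (P : G -> Prop).

Lemma nbr_fset X y : nbr E (fset_pred X) y <-> y \in prodf X S.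
Proof.
split=> [[x [xX /ES]]|/prodfP[x xX xyS]]; first by move=> ?; apply/prodfP; exists x.
by exists x; split=> //; apply/ES.
Qed.

Lemma bd_fset X : bd E (fset_pred X) = fset_pred (prodf X S `\` X).
Proof.
apply/funext=> y; apply/propext; rewrite /bd /fset_pred in_fsetD; split.
  by move=> [/nbr_fset -> /negP ->].
by move=> /andP[/negP yX /nbr_fset yXS].
Qed.

Lemma card_bd X : #|` prodf X S `\` X| = #|` prodf X S| - #|` X|.
Proof. by rewrite cardfsDS // sub_prodf. Qed.

Lemma leq_card_prodf X : #|` X| <= #|` prodf X S|.
Proof. exact/fsubset_leq_card/sub_prodf. Qed.

Lemma atleast_nabla k X : atleast k (nabla E (fset_pred X)) <-> coatleast k (prodf X S).
Proof.
rewrite atleastE; split=> -[N kN dN]; exists N => //.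
  by apply/fdisjointP=> x /dN nx; apply/negP=> /nbr_fset.
by move=> x /(fdisjointP dN)/negP nx /nbr_fset.
Qed.

Lemma admissible_fset k X :
  admissible E k (fset_pred X) <-> k <= #|` X| /\ coatleast k (prodf X S).
Proof.
rewrite /admissible atleast_nabla atleast_fset; split=> [[_]//|[kX dX]].
by split=> //; exists #|` X|; apply/card_is_fset.
Qed.

Lemma admissibleE k P : admissible E k P -> exists X, P = fset_pred X.
Proof. by case=> -[n /card_isE]. Qed.

Lemma kappa_le k c : is_kappa E k c -> forall X, k <= #|` X| -> coatleast k (prodf X S) ->
  #|` X| + c <= #|` prodf X S|.
Proof.
move=> [_ kappa] X kX dX; have := kappa (fset_pred X); rewrite bd_fset admissible_fset.
by move=> /(_ (conj kX dX)) /atleast_fset; rewrite card_bd; have := leq_card_prodf X; lia.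
Qed.

Lemma kappa1_le c : is_kappa E 1 c -> forall X w, X != fset0 -> w \notin prodf X S ->
  #|` X| + c <= #|` prodf X S|.
Proof.
move=> kappa X w nzX wX; apply: (kappa_le kappa); first by rewrite cardfs_gt0.
exact: coatleast_out wX.
Qed.

Lemma kappa_leq k c d : is_kappa E k c -> is_kappa E k d -> c <= d.
Proof.
move=> [_ kc] [[P [aP bP]] _]; have [X eP] := admissibleE aP; subst P.
move: bP; rewrite bd_fset => /card_is_fset <-.
by apply/atleast_fset; rewrite -bd_fset; apply: kc.
Qed.

Lemma kappa_unique k c d : is_kappa E k c -> is_kappa E k d -> c = d.
Proof. by move=> kc kd; apply/eqP; rewrite eqn_leq !(@kappa_leq k). Qed.

Section Kappa.
Variable c : nat.
Hypothesis kappa2 : is_kappa E 2 c.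

Lemma fragment_fset X : fragment E 2 (fset_pred X) <-> frag S c X.
Proof.
rewrite /fragment bd_fset admissible_fset; split=> [[[X2 dX] [d [kd /card_is_fset]]]|[X2 dX tX]].
  by rewrite card_bd (kappa_unique kd kappa2) => dc; split=> //; have := leq_card_prodf X; lia.
by split=> //; exists c; split=> //; apply/card_is_fset; rewrite card_bd tX addKn.
Qed.

Lemma fragmentE P : fragment E 2 P -> exists X, P = fset_pred X.
Proof. by case=> /admissibleE. Qed.

Lemma atom_fset A : atom E 2 (fset_pred A) <-> min_frag S c A.
Proof.
rewrite /atom fragment_fset; split=> -[fA mA]; split=> // Y fY.
  by apply/atleast_fset; apply: mA; [apply/fragment_fset|apply/card_is_fset].
have [X eY] := fragmentE fY; subst Y => m /card_is_fset <-.
by apply/atleast_fset/mA/fragment_fset.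
Qed.

Lemma faithful_fset :
  faithful E 2 <-> exists2 A, min_frag S c A & coatleast #|` A| (prodf A S).
Proof.
split=> [[P [aP [n [cP nP]]]]|[A mA dA]].
  have [[/admissibleE[A eP] _] _] := aP; subst P; exists A; first exact/atom_fset.
  by move/card_is_fset: cP => ->; apply/atleast_nabla.
exists (fset_pred A); split; first exact/atom_fset.
by exists #|` A|; split; [apply/card_is_fset|apply/atleast_nabla].
Qed.

Lemma frag_exists : exists X, frag S c X.
Proof.
have [[P [aP bP]] _] := kappa2; have [X eP] := admissibleE aP; subst P.
by exists X; apply/fragment_fset; split=> //; exists c.
Qed.

Lemma min_frag_exists : exists A, min_frag S c A.
Proof.
have ex : exists n, `[< exists2 X, frag S c X & #|` X| = n >].
  by have [X fX] := frag_exists; exists #|` X|; apply/asboolP; exists X.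
case: (ex_minnP ex) => n /asboolP[A fA cA] mA; exists A; split=> // X fX.
by rewrite cA; apply: mA; apply/asboolP; exists X.
Qed.

Hypothesis kappa1 : is_kappa E 1 c.

(** Some translate of a 1-admissible set contains 1, and its product still misses a point. *)
Lemma singleton_admissible : coatleast 1 (prodf [fset 1%g] S).
Proof.
have [[P [aP _]] _] := kappa1; have [X eP] := admissibleE aP; subst P.
have [X1 dX] := proj1 (admissible_fset 1 X) aP.
have [x xX] : exists x, x \in X by apply/fset0Pn; rewrite -cardfs_gt0.
have := coatleast_transl x^-1%g dX; rewrite -prodf_transl; apply: coatleastS.
apply: prodfS; apply/fsubsetP=> y; rewrite in_fset1 => /eqP->.
by rewrite mem_transl invgK mulg1.
Qed.

Lemma card_prodf1 : #|` prodf [fset 1%g] S| = #|` S|.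
Proof. by rewrite prodf1 card_transl. Qed.

(** The set {1} is 1-admissible with a boundary of |S| - 1 points. *)
Lemma kappa_leq_card : c < #|` S|.
Proof.
have := kappa_le kappa1 _ singleton_admissible.
by rewrite card_prodf1 cardfs1 add1n; apply.
Qed.

(** Equality makes {1} a 1-fragment, necessarily of minimum size. *)
Lemma cauchy_fset : #|` S| = c.+1 -> cauchy E.
Proof.
move=> cS; right; exists (fset_pred [fset 1%g]); split; last first.
  by left; apply/card_is_fset; rewrite cardfs1.
split.
  split; first by apply/admissible_fset; rewrite cardfs1; split=> //; exact: singleton_admissible.
  exists c; split=> //; rewrite bd_fset; apply/card_is_fset.
  by rewrite card_bd card_prodf1 cardfs1 cS subn1.
by move=> Y [[_ [Y1 _]] _] m /card_is_fset <-; rewrite cardfs1.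
Qed.

End Kappa.
End Bridge.

(** * Case analysis for the Cayley graph and its reverse *)

Section CayleyGraph.
Variables (G : groupType) (S : {fset G}).
Hypothesis S1 : 1%g \in S.
Let mulG : G -> G -> G := fun x y => (x * y)%g.
Let invG : G -> G := fun x => x^-1%g.
Let oneG : G := 1%g.
Let E := cay mulG invG (fset_pred S).
Let E' := rev_graph E.
Let T : {fset G} := [fset x^-1%g | x in S].

Lemma mem_invS x : (x \in T) = (x^-1%g \in S).
Proof.
apply/imfsetP/idP => [[s /= sS ->]|xS]; first by rewrite invgK.
by exists x^-1%g; rewrite ?invgK.
Qed.

Lemma subgroup_finite (H : {fset G}) : subgroup H ->
  is_finite_subgroup mulG oneG invG (fset_pred H).
Proof. by case=> H1 HM HV; split=> //; exists #|` H|; apply/card_is_fset. Qed.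

Lemma degenerate_cayley : degenerate E -> degenerate E' ->
  exists H : G -> Prop, is_finite_subgroup mulG oneG invG H /\
    ((fragment E 2 H \/ fragment E' 2 H) \/
     (faithful E 2 /\ faithful E' 2 /\ cauchy E /\ cauchy E' /\
      exists a : G, let K := fun x => H x \/ exists h, H h /\ x = mulG h a in
        atom E 2 K \/ atom E' 2 K)).
Proof.
move=> [_ [c [k2 k1]]] [_ [d [l2 l1]]].
have T1 : 1%g \in T by rewrite mem_invS invg1.
have cT : #|` T| = #|` S| by rewrite card_imfset //; exact: invg_inj.
have ES x y : E x y <-> (x^-1 * y)%g \in S by [].
have ET x y : E' x y <-> (x^-1 * y)%g \in T by rewrite mem_invS invgM invgK.
have TS := mem_invS; have ST x : (x \in S) = (x^-1%g \in T) by rewrite TS invgK.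
have kS := kappa1_le S1 ES k1; have kT := kappa1_le T1 ET l1.
(* An unfaithful graph yields a subgroup that is a fragment of the other graph, so the roles of S
   and T are exchanged. *)
have [fE|nfE] := pselect (faithful E 2); last first.
  have [A mA] := min_frag_exists T1 ET l2; have [B mB] := min_frag_exists S1 ES k2.
  have [||H sH fH] := unfaithful_subgroup ST kT kS _ mB.
  - exact: frag_exists l2.
  - by move=> dB; apply/nfE/(faithful_fset S1 ES k2); exists B.
  exists (fset_pred H); split; first exact: subgroup_finite.
  by left; right; apply/(fragment_fset T1 ET l2).
have [fE'|nfE'] := pselect (faithful E' 2); last first.
  have [A mA] := min_frag_exists T1 ET l2.
  have [||H sH fH] := unfaithful_subgroup TS kS kT _ mA.
  - exact: frag_exists k2.
  - by move=> dA; apply/nfE'/(faithful_fset T1 ET l2); exists A.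
  exists (fset_pred H); split; first exact: subgroup_finite.
  by left; left; apply/(fragment_fset S1 ES k2).
have [A mA dA] := proj1 (faithful_fset S1 ES k2) fE.
have [B mB dB] := proj1 (faithful_fset T1 ET l2) fE'.
(* Both graphs are now faithful. If c + 1 < |S| or d + 1 < |T|, a translate of the corresponding
   atom is a subgroup. *)
have := kappa_leq_card S1 ES k1; rewrite leq_eqVlt => /orP[/eqP cS|cS]; last first.
  have [H sH fH] := min_frag_subgroup kS mA dA cS.
  exists (fset_pred H); split; first exact: subgroup_finite.
  by left; left; apply/(fragment_fset S1 ES k2).
have := kappa_leq_card T1 ET l1; rewrite leq_eqVlt => /orP[/eqP dT|dT]; last first.
  have [H sH fH] := min_frag_subgroup kT mB dB dT.
  exists (fset_pred H); split; first exact: subgroup_finite.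
  by left; right; apply/(fragment_fset T1 ET l2).
have [a aA] : exists a, a \in A.
  by apply/fset0Pn; rewrite -cardfs_gt0; case: mA => -[/ltnW].
(* The coset description needs an atom through 1. *)
have mA' := min_frag_transl a^-1%g mA.
have [||H sH HA] := min_frag_two_cosets S1 kS (esym cS) mA'.
- by rewrite mem_transl invgK mulg1.
- by rewrite card_transl prodf_transl; apply: coatleast_transl.
exists (fset_pred H); split; first exact: subgroup_finite.
case: HA => [HA|[b HA]].
  by left; left; apply/(fragment_fset S1 ES k2); rewrite -HA; case: mA'.
right; do 2!split=> //; split; first exact: cauchy_fset k1 (esym cS).
split; first exact: cauchy_fset l1 (esym dT).
exists b => K; left.
have -> : K = fset_pred (transl a^-1%g A).
  apply/funext=> x; apply/propext; rewrite HA /K /fset_pred in_fsetU.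
  split=> [[->//|[h [hH ->]]]|/orP[|/imfsetP[h /= hH ->]]]; [|by left|by right; exists h].
  by apply/orP; right; apply/imfsetP; exists h.
exact/(atom_fset S1 ES k2).
Qed.

End CayleyGraph.

(** * Transfer to a group given by bare operations *)

Theorem theorem8p4 (G : Type) (mul : G -> G -> G) (one : G) (inv : G -> G)
  (S : G -> Prop) :
  is_group mul one inv ->
  finite S -> S one -> generates mul one inv S ->
  degenerate (cay mul inv S) -> degenerate (rev_graph (cay mul inv S)) ->
  exists H : G -> Prop, is_finite_subgroup mul one inv H /\
    ( (fragment (cay mul inv S) 2 H \/ fragment (rev_graph (cay mul inv S)) 2 H)
    \/
      (faithful (cay mul inv S) 2 /\ faithful (rev_graph (cay mul inv S)) 2 /\
       cauchy (cay mul inv S) /\ cauchy (rev_graph (cay mul inv S)) /\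
       exists a : G,
         let K := fun x => H x \/ exists h, H h /\ x = mul h a in
         atom (cay mul inv S) 2 K \/ atom (rev_graph (cay mul inv S)) 2 K)).
Proof.
move=> [mA [m1l [m1r [mVl mVr]]]] [n fS] S1 _ dE dE'.
(* [{classic G}] supplies the decidable equality and choice that finite sets require. *)
pose K : groupType := HB.pack {classic G}
  (isGroup.Build {classic G} mA m1l m1r mVl mVr).
have [X eS] := @card_isE K S n fS; subst S.
exact: (@degenerate_cayley K X S1 dE dE').
Qed.
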